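(* Let $U:\mathbb{R}^3\to\mathbb{R}$ and $A:\mathbb{R}^3\to\mathbb{R}^3$ be such that the magnetic field $\nabla\times A(x)=B$ is constant, and suppose that for some skew-symmetric matrix $S\in\mathbb{R}^{3\times3}$ $$U(e^{\tau S}x)=U(x),\qquad e^{-\tau S}A(e^{\tau S}x)=A(x)\qquad\text{for all real }\tau\text{ and all }x.$$ Let $F=-\nabla U$ and let $(x_n,v_n)$ be the numerical solution obtained with stepsize $h>0$ by the method $$x_{n+1}=x_n+h\,v_{n+1/2},\qquad v_{n+1}=v_n+h\,v_{n+1/2}\times B+h\,F(x_{n+1/2}),$$ where $v_{n+1/2}=\frac{v_n+v_{n+1}}2$ and $x_{n+1/2}=\frac{x_n+x_{n+1}}2$. Assume that the numerical solution $(x_n,v_n)$ stays in a compact set that is independent of $h$. Let $N\ge2$ be an arbitrary integer. Then the momentum $M(x,v)=(v+A(x))^{\intercal}Sx$ satisfies $$|M(x_{n+1/2},v_{n+1/2})-M(x_{1/2},v_{1/2})|\le C_2h^2\qquad\text{for } nh\le h^{-N},$$ where the constant $C_2$ is independent of $n$ and $h$ as long as $nh\le h^{-N}$.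
   Context: The method (called TSM1) is applied to the charged-particle dynamics $\ddot x=\dot x\times B(x)+F(x)$ in $\mathbb{R}^3$ in a normal magnetic field (scaling parameter $\epsilon=1$), where $B=\nabla\times A$, $F=-\nabla U$, $v=\dot x$. The potentials $U$ and $A$ are assumed smooth; $\times$ is the cross product. The initial values $x_0$ and $v_0$ are bounded independently of $h$. Under the stated invariance of $U$ and $A$, $M$ is conserved along exact solutions. *)

(* Defs.v *)
From HB Require Import structures.
From mathcomp Require Import all_boot all_order all_algebra.
From mathcomp Require Import all_classical all_reals all_analysis.

Set Implicit Arguments.
Unset Strict Implicit.
Unset Printing Implicit Defensive.

Import Order.TTheory GRing.Theory Num.Theory.
Import numFieldNormedType.Exports.

Local Open Scope classical_set_scope.
Local Open Scope ring_scope.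

(* On a finite-dimensional space, having all directional derivatives of class
   C^k is the same as having all first partial derivatives of class C^k. *)
Fixpoint of_class_C (R : realType) (V W : normedModType R) (k : nat)
    (f : V -> W) : Prop :=
  if k is k'.+1 then
    (forall x, differentiable f x) /\
    (forall w, of_class_C k' (fun x => 'D_w f x))
  else continuous f.

Definition smooth (R : realType) (V W : normedModType R) (f : V -> W) : Prop :=
  forall k, of_class_C k f.

Definition expmx (R : realType) (n : nat) (X : 'M[R]_n.+1) : 'M[R]_n.+1 :=
  lim (series (fun k => (k`!%:R)^-1 *: X ^+ k) @ \oo).

Definition partial (R : realType) (i : 'I_3) (f : 'cV[R]_3 -> R)
    (x : 'cV[R]_3) : R :=
  'D_(delta_mx i 0) f x.

Definition grad (R : realType) (f : 'cV[R]_3 -> R) (x : 'cV[R]_3) : 'cV[R]_3 :=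
  \col_i partial i f x.

(* In crossmul and curl the indices i + 1 and i + 2 are computed in 'I_3,
   that is modulo 3. *)
Definition crossmul (R : realType) (u v : 'cV[R]_3) : 'cV[R]_3 :=
  \col_i (u (i + 1) 0 * v (i + 2) 0 - u (i + 2) 0 * v (i + 1) 0).

Definition curl (R : realType) (A : 'cV[R]_3 -> 'cV[R]_3) (x : 'cV[R]_3) :
    'cV[R]_3 :=
  \col_i (partial (i + 1) (fun y => A y (i + 2) 0) x
          - partial (i + 2) (fun y => A y (i + 1) 0) x).

Definition midpoint (R : realType) (u : nat -> 'cV[R]_3) (n : nat) : 'cV[R]_3 :=
  2^-1 *: (u n + u n.+1).

Definition TSM1 (R : realType) (F : 'cV[R]_3 -> 'cV[R]_3) (B : 'cV[R]_3)
    (h : R) (x v : nat -> 'cV[R]_3) : Prop :=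
  forall n,
    x n.+1 = x n + h *: midpoint v n /\
    v n.+1 = v n + h *: crossmul (midpoint v n) B + h *: F (midpoint x n).

Definition momentum (R : realType) (A : 'cV[R]_3 -> 'cV[R]_3) (S : 'M[R]_3)
    (x v : 'cV[R]_3) : R :=
  ((v + A x)^T *m S *m x) 0 0.

(* Main.v *)
Require Import Defs.
From HB Require Import structures.
From mathcomp Require Import all_boot all_order all_algebra.
From mathcomp Require Import all_classical all_reals all_analysis.
From mathcomp Require Import ring lra.

(** The method is the implicit midpoint rule for [x' = v, v' = v x B + F(x)],
    and the midpoint rule preserves every quadratic first integral.  The momentum
    [M(x, v) = v^T S x + A(x)^T S x] is one: although [A] itself may contain a
    nonlinear gradient, the invariance of [A] and the constancy of its curl force
    [A(x)^T S x] to have the derivative [w |-> - (w x B).(S x)], linear in [x]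
    ([is_derive_potential_momentum]).  So [M] is a quadratic polynomial.

    Consequently [M(x_n, v_n)] does not depend on [n] at all
    ([momentum_TSM1_step]): along a step the two magnetic contributions cancel,
    and the force drops out because [U] is constant along the orbits of
    [expmx (tau *: S)], so that [F(x).(S x) = 0] ([derive_invariant]).  The
    midpoints are not on the numerical trajectory, but for a quadratic
    polynomial the value at the middle of two points differs from the mean of
    the values at these points by a quadratic expression in their difference,
    here [h * (v, v x B + F(x))] taken at the midpoint.  Hence
    [M(x_{n+1/2}, v_{n+1/2})] is the conserved value plus [h^2] times a
    continuous function of the two consecutive states ([midpoint_defect]), and
    this function is bounded on the compact set of pairs of states in [K].

    The invariance hypotheses are used through their derivatives at parameter 0,
    which requires the derivative of the matrix exponential there
    ([is_derive_expmx_entry]); it is obtained entrywise from the theory of real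
    power series. *)

Set Implicit Arguments.
Unset Strict Implicit.
Unset Printing Implicit Defensive.

Import Order.TTheory GRing.Theory Num.Theory.
Import numFieldNormedType.Exports.

Local Open Scope classical_set_scope.
Local Open Scope ring_scope.

(** * The exponential curve of a matrix *)

Lemma cvg_mx (R : realType) (m n : nat) (M : nat -> 'M[R]_(m, n))
    (L : 'M[R]_(m, n)) :
  (forall i j, M k i j @[k --> \oo] --> L i j) -> M @ \oo --> L.
Proof.
move=> ML; apply/cvgrPdist_le => /= e e0; near=> k.
rewrite /Num.Def.normr/= mx_normrE (bigmax_le _ (ltW e0))//= => ij _.
rewrite !mxE/=; move: ij; near: k; apply: filter_forall => /= ij.
exact: ((cvgrPdist_le _ _).1 (ML ij.1 ij.2)).
Unshelve. all: by end_near. Qed.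

Lemma pseries_at0 (R : realType) (c : nat -> R) : limn (pseries c 0) = c 0%N.
Proof.
apply: lim_near_cst => //; near=> m.
rewrite -[m]prednK; last by near: m; exists 1%N.
rewrite /pseries /series /= big_nat_recl// expr0 mulr1 big1 ?addr0// => i _.
by rewrite expr0n mulr0.
Unshelve. all: by end_near. Qed.

(** A coefficient sequence of at most geometric growth, divided by the
    factorials, is dominated by a multiple of an exponential series. *)
Lemma is_cvg_pseries_div_fact (R : realType) (c : nat -> R) (C a t : R) :
  0 <= a -> (forall k, `|c k| <= C * a ^+ k) ->
  cvgn (pseries (fun k => (k`!%:R)^-1 * c k) t).
Proof.
move=> a0 ca; have C0 : 0 <= C.
  by have := le_trans (normr_ge0 _) (ca 0%N); rewrite expr0 mulr1.
apply: normed_cvg.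
apply: (@series_le_cvg _ _ (fun k => C * exp_coeff (a * `|t|) k)) => /=.
- by [].
- by move=> k; rewrite mulr_ge0// divr_ge0// exprn_ge0// mulr_ge0.
- move=> k; rewrite !normrM normrX ger0_norm// /exp_coeff/= exprMn.
  rewrite [leRHS](_ : _ = (k`!%:R)^-1 * (C * a ^+ k) * `|t| ^+ k); last by ring.
  by rewrite ler_wpM2r ?exprn_ge0// ler_wpM2l.
- have := @is_cvg_seriesZ _ _ C (is_cvg_series_exp_coeff (a * `|t|)).
  by [].
Qed.

(** Formal differentiation of [sum c k t^k / k!] merely shifts [c], and the
    geometric bound survives the shift; all the derived series demanded by the
    theorem on termwise differentiation therefore converge everywhere. *)
Lemma is_derive_pseries_div_fact0 (R : realType) (c : nat -> R) (C a : R) :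
  0 <= a -> (forall k, `|c k| <= C * a ^+ k) ->
  is_derive (0 : R) (1 : R)
    (fun t => limn (pseries (fun k => (k`!%:R)^-1 * c k) t)) (c 1%N).
Proof.
move=> a0 ca; set f := fun k => _ * c k.
have diffsE (d : nat -> R) : pseries_diffs (fun k => (k`!%:R)^-1 * d k) =
    (fun k => (k`!%:R)^-1 * d k.+1).
  apply/funext => k; rewrite /pseries_diffs factS natrM invfM.
  by rewrite !mulrA mulfV// mul1r.
have shift (d : nat -> R) D : (forall k, `|d k| <= D * a ^+ k) ->
    forall k, `|d k.+1| <= D * a * a ^+ k.
  by move=> da k; rewrite -mulrA -exprS.
have -> : c 1%N = limn (pseries (pseries_diffs f) 0).
  by rewrite pseries_at0 diffsE fact0 invr1 mul1r.
apply: (@pseries_snd_diffs _ _ 1).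
- exact: is_cvg_pseries_div_fact ca.
- by rewrite diffsE; exact: is_cvg_pseries_div_fact (shift _ _ ca).
- by rewrite !diffsE; apply: is_cvg_pseries_div_fact (shift _ _ (shift _ _ ca)).
- by rewrite normr0 normr1.
Qed.

(** The sum of the absolute values of all entries is a submultiplicative norm,
    and it dominates every entry. *)
Lemma norm_mx_exp_entry_le (R : realType) (n : nat) (S : 'M[R]_n.+1) i j k :
  `|(S ^+ k) i j| <= (\sum_p \sum_q `|S p q|) ^+ k.
Proof.
elim: k i j => [|k IHk] i j.
  by rewrite !expr0 !mxE; case: eqP => _; rewrite ?normr1 ?normr0.
rewrite !exprS mxE; apply: le_trans (ler_norm_sum _ _ _) _.
apply: (@le_trans _ _ (\sum_q `|S i q| * (\sum_p \sum_q `|S p q|) ^+ k)).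
  by apply: ler_sum => q _; rewrite normrM ler_wpM2l.
rewrite -mulr_suml ler_wpM2r ?exprn_ge0//.
  by apply: sumr_ge0 => p _; exact: sumr_ge0.
by rewrite [leRHS](bigD1 i)//= lerDl; apply: sumr_ge0 => p _; exact: sumr_ge0.
Qed.

(** Reduces the exponential, a limit in a space of matrices, to scalar power
    series in the parameter, for which termwise differentiation is at hand. *)
Lemma expmx_scale_entry (R : realType) (n : nat) (S : 'M[R]_n.+1) t i j :
  expmx (t *: S) i j = limn (pseries (fun k => (k`!%:R)^-1 * (S ^+ k) i j) t).
Proof.
pose L := \matrix_(p, q)
  limn (pseries (fun k => (k`!%:R)^-1 * (S ^+ k) p q) t) : 'M[R]_n.+1.
suff -> : expmx (t *: S) = L by rewrite mxE.
apply: (@cvg_lim _ (@norm_hausdorff _ _)); apply: cvg_mx => p q; rewrite mxE.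
rewrite [X in X @ \oo --> _](_ : _ =
    pseries (fun k => (k`!%:R)^-1 * (S ^+ k) p q) t).
  apply: (is_cvg_pseries_div_fact (C := 1) (a := \sum_p \sum_q `|S p q|)).
    by apply: sumr_ge0 => ? _; exact: sumr_ge0.
  by move=> k; rewrite mul1r; exact: norm_mx_exp_entry_le.
apply/funext => m; rewrite /pseries /series /= summxE; apply: eq_bigr => k _.
by rewrite exprZn !mxE mulrA mulrAC.
Qed.

Lemma expmx_scale0 (R : realType) (n : nat) (S : 'M[R]_n.+1) :
  expmx (0 *: S) = 1%:M.
Proof.
apply/matrixP => i j; rewrite expmx_scale_entry pseries_at0 fact0 invr1 mul1r.
by rewrite expr0.
Qed.

Lemma is_derive_expmx_entry (R : realType) (n : nat) (S : 'M[R]_n.+1) i j :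
  is_derive (0 : R) (1 : R) (fun t => expmx (t *: S) i j) (S i j).
Proof.
under [X in is_derive _ _ X _]funext do rewrite expmx_scale_entry.
apply: (is_derive_pseries_div_fact0 (C := 1) (a := \sum_p \sum_q `|S p q|)).
  by apply: sumr_ge0 => ? _; exact: sumr_ge0.
by move=> k; rewrite mul1r; exact: norm_mx_exp_entry_le.
Qed.

(** * Infinitesimal form of the invariance of the potentials *)

Lemma is_derive_sum_pt (R : realType) (m : nat) (f : 'I_m -> R -> R) (t : R)
    (df : 'I_m -> R) :
  (forall i, is_derive t (1 : R) (f i) (df i)) ->
  is_derive t (1 : R) (fun s => \sum_i f i s) (\sum_i df i).
Proof.
move=> fd; rewrite [X in is_derive _ _ X _](_ : _ = \sum_i f i).
  exact: is_derive_sum.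
by apply/funext => s; rewrite fct_sumE.
Qed.

(** The chain rule along a curve given by its coordinates. *)
Lemma is_derive_comp_curve (R : realType) (m : nat) (f : 'cV[R]_m -> R)
    (gamma : R -> 'cV[R]_m) (t : R) (w : 'cV[R]_m) :
  (forall i, is_derive t (1 : R) (fun s => gamma s i 0) (w i 0)) ->
  differentiable f (gamma t) ->
  is_derive t (1 : R) (fun s => f (gamma s)) ('D_w f (gamma t)).
Proof.
move=> dgamma df.
have gammad : derivable gamma t 1.
  by apply/derivable_mxP => i j; rewrite ord1; case: (dgamma i).
have dgammaE : 'D_1 gamma t = w.
  by rewrite derive_mx//; apply/colP => i; rewrite mxE; case: (dgamma i).
have gammad' : differentiable gamma t by exact/derivable1_diffP.
have fgd : differentiable (f \o gamma) t by exact: differentiable_comp.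
apply: DeriveDef; first exact/derivable1_diffP.
by rewrite (deriveE _ fgd) diff_comp//= -(deriveE _ gammad') dgammaE deriveE.
Qed.

Lemma is_derive_orbit (R : realType) (n : nat) (S : 'M[R]_n.+1)
    (f : 'cV[R]_n.+1 -> R) (x : 'cV[R]_n.+1) :
  differentiable f x ->
  is_derive (0 : R) (1 : R) (fun t => f (expmx (t *: S) *m x))
    ('D_(S *m x) f x).
Proof.
move=> df; have E0 : expmx (0 *: S) *m x = x by rewrite expmx_scale0 mul1mx.
have := @is_derive_comp_curve R _ f (fun t => expmx (t *: S) *m x) 0 (S *m x).
rewrite E0; apply => // i; rewrite mxE.
under [X in is_derive _ _ X _]funext do rewrite mxE.
apply: is_derive_sum_pt => j.
have := is_derive_expmx_entry S i j => dE.
have dc : is_derive (0 : R) (1 : R) (fun=> x j 0) 0 by exact: is_derive_cst.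
by apply: is_derive_eq (is_deriveM dE dc) _; rewrite scaler0 add0r mulrC.
Qed.

(** Noether's condition for a scalar potential: differentiate the invariance at
    parameter 0, where the orbit through [x] has velocity [S *m x]. *)
Lemma derive_invariant (R : realType) (n : nat) (S : 'M[R]_n.+1)
    (f : 'cV[R]_n.+1 -> R) (x : 'cV[R]_n.+1) :
  differentiable f x -> (forall t, f (expmx (t *: S) *m x) = f x) ->
  'D_(S *m x) f x = 0.
Proof.
move=> df finv; have := is_derive_orbit S df.
rewrite (_ : (fun t : R => _) = cst (f x)); last exact/funext.
by move=> [_ <-]; exact: derive_cst.
Qed.

(** The derivative at parameter 0 of the constant curve
    [expmx (- t *: S) *m A (expmx (t *: S) *m x)] is [A'(x) S x - S A(x)],
    by the product rule applied to the two exponentials. *)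
Lemma derive_equivariant (R : realType) (n : nat) (S : 'M[R]_n.+1)
    (A : 'cV[R]_n.+1 -> 'cV[R]_n.+1) (x : 'cV[R]_n.+1) i :
  (forall j, differentiable (fun y => A y j 0) x) ->
  (forall t, expmx (- t *: S) *m A (expmx (t *: S) *m x) = A x) ->
  'D_(S *m x) (fun y => A y i 0) x = (S *m A x) i 0.
Proof.
move=> dA Ainv.
have dE j : is_derive (0 : R) (1 : R) (fun t => expmx (- t *: S) i j) (- S i j).
  under [X in is_derive _ _ X _]funext do rewrite scaleNr -scalerN.
  by have := is_derive_expmx_entry (- S) i j; rewrite [(- S) i j]mxE.
have dP : is_derive (0 : R) (1 : R)
    (fun t => (expmx (- t *: S) *m A (expmx (t *: S) *m x)) i 0)
    (\sum_j (expmx (- 0 *: S) i j *: 'D_(S *m x) (fun y => A y j 0) x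
       + A (expmx (0 *: S) *m x) j 0 *: - S i j)).
  under [X in is_derive _ _ X _]funext do rewrite mxE.
  apply: is_derive_sum_pt => j.
  exact: is_deriveM (dE j) (is_derive_orbit S (dA j)).
move: dP; rewrite (_ : (fun t : R => _) = cst (A x i 0)); last first.
  by apply/funext => t; rewrite Ainv.
move=> [_]; rewrite derive_cst.
rewrite oppr0 expmx_scale0 mul1mx big_split/= mxE => /esym/eqP.
rewrite (bigD1 i)//= mxE eqxx scale1r [X in _ + X + _]big1 ?addr0; last first.
  by move=> j ji; rewrite mxE eq_sym (negPf ji) scale0r.
rewrite addr_eq0 -sumrN => /eqP ->; apply: eq_bigr => j _.
by rewrite scalerN opprK /GRing.scale/= mulrC.
Qed.

Lemma derive_partials (R : realType) (f : 'cV[R]_3 -> R) (x w : 'cV[R]_3) :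
  differentiable f x -> 'D_w f x = \sum_j w j 0 * partial j f x.
Proof.
move=> df; rewrite deriveE// [in LHS](matrix_sum_delta w) linear_sum.
apply: eq_bigr => j _; rewrite big_ord1 linearZ /=.
by rewrite /partial deriveE.
Qed.

(** * The bilinear form of the momentum *)

(** The form [u^T S w] in which the momentum is [bilin S v x + bilin S (A x) x];
    its second summand is called below the momentum of the vector potential. *)
Definition bilin (R : realType) (n : nat) (S : 'M[R]_n) (u w : 'cV[R]_n) : R :=
  (u^T *m S *m w) 0 0.

Lemma bilinE (R : realType) (n : nat) (S : 'M[R]_n) (u w : 'cV[R]_n) :
  bilin S u w = \sum_i u i 0 * (S *m w) i 0.
Proof.
by rewrite /bilin -mulmxA mxE; apply: eq_bigr => i _; rewrite !mxE.
Qed.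

Lemma bilinDl (R : realType) (n : nat) (S : 'M[R]_n) (u u' w : 'cV[R]_n) :
  bilin S (u + u') w = bilin S u w + bilin S u' w.
Proof. by rewrite /bilin linearD/= !mulmxDl mxE. Qed.

Lemma bilinDr (R : realType) (n : nat) (S : 'M[R]_n) (u w w' : 'cV[R]_n) :
  bilin S u (w + w') = bilin S u w + bilin S u w'.
Proof. by rewrite /bilin mulmxDr mxE. Qed.

Lemma bilinZl (R : realType) (n : nat) (S : 'M[R]_n) a (u w : 'cV[R]_n) :
  bilin S (a *: u) w = a * bilin S u w.
Proof. by rewrite /bilin linearZ/= -!scalemxAl mxE. Qed.

Lemma bilinZr (R : realType) (n : nat) (S : 'M[R]_n) a (u w : 'cV[R]_n) :
  bilin S u (a *: w) = a * bilin S u w.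
Proof. by rewrite /bilin -scalemxAr mxE. Qed.

Lemma bilin_skewC (R : realType) (n : nat) (S : 'M[R]_n) (u w : 'cV[R]_n) :
  S^T = - S -> bilin S u w = - bilin S w u.
Proof.
move=> S_skew; rewrite /bilin.
have -> : (u^T *m S *m w) 0 0 = (u^T *m S *m w)^T 0 0 by rewrite [RHS]mxE.
by rewrite !trmx_mul trmxK S_skew mulNmx mulmxN mulmxA [LHS]mxE.
Qed.

Lemma bilin_skew_diag (R : realType) (n : nat) (S : 'M[R]_n) (u : 'cV[R]_n) :
  S^T = - S -> bilin S u u = 0.
Proof. by move=> S_skew; have e := bilin_skewC u u S_skew; lra. Qed.

Lemma momentumE (R : realType) (A : 'cV[R]_3 -> 'cV[R]_3) (S : 'M[R]_3)
    (x v : 'cV[R]_3) :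
  momentum A S x v = bilin S v x + bilin S (A x) x.
Proof. exact: bilinDl. Qed.

Lemma crossmulZl (R : realType) a (u w : 'cV[R]_3) :
  crossmul (a *: u) w = a *: crossmul u w.
Proof. by apply/colP => i; rewrite !mxE; ring. Qed.

Lemma sum_I3 (R : realType) (f : 'I_3 -> R) :
  \sum_i f i = f 0 + f 1 + f (1 + 1).
Proof.
rewrite !big_ord_recl big_ord0 addr0 addrA.
by congr (f _ + f _ + f _); apply: val_inj.
Qed.

(** * The momentum of the vector potential is quadratic *)

(** With [y = x + t *: w] and [u = S y], the derivative of [A(y)^T S y] along [w]
    is [(A'(y) w).u + A(y).(S w)].  As [S] is skew, the second term is
    [- w.(S A(y))], which by equivariance is [- w.(A'(y) u)].  What is left only
    involves the antisymmetric part of [A'(y)], that is the curl: the derivative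
    is [- (w x B).u].  In particular it is affine in [y] when [B] is constant,
    whatever nonlinear gradient is hidden in [A]. *)
Lemma is_derive_potential_momentum (R : realType) (A : 'cV[R]_3 -> 'cV[R]_3)
    (B : 'cV[R]_3) (S : 'M[R]_3) (x w : 'cV[R]_3) (t : R) :
  (forall y, differentiable A y) -> (forall y, curl A y = B) -> S^T = - S ->
  (forall tau y, expmx (- tau *: S) *m A (expmx (tau *: S) *m y) = A y) ->
  is_derive t (1 : R) (fun s => bilin S (A (x + s *: w)) (x + s *: w))
    (- bilin S (crossmul w B) (x + t *: w)).
Proof.
move=> dA curlA S_skew Ainv; set y := x + t *: w.
have dAi i z : differentiable (fun z => A z i 0) z.
  exact: (differentiable_comp (dA z) (differentiable_coord _ _ _)).
have dline i : is_derive t (1 : R) (fun s => (x + s *: w) i 0) (w i 0).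
  rewrite (_ : (fun _ => _) = cst (x i 0) + w i 0 *: id); last first.
    by apply/funext => s; rewrite !mxE mulrC.
  apply: is_derive_eq (is_deriveD (is_derive_cst _ _ _)
    (is_deriveZ (w i 0) (is_derive_id t (1 : R)))) _.
  by rewrite add0r [_ *: _]mulr1.
have dSline i : is_derive t (1 : R) (fun s => (S *m (x + s *: w)) i 0)
    ((S *m w) i 0).
  rewrite (_ : (fun _ => _) = (fun s => \sum_j S i j * (x + s *: w) j 0)).
    rewrite mxE.
    exact: (is_derive_sum_pt (fun j => is_deriveZ (S i j) (dline j))).
  by apply/funext => s; rewrite mxE.
have dg : is_derive t (1 : R)
    (fun s => bilin S (A (x + s *: w)) (x + s *: w))
    (\sum_i (A y i 0 *: (S *m w) i 0
       + (S *m y) i 0 *: 'D_w (fun z => A z i 0) y)).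
  rewrite (_ : (fun _ => _) =
    (fun s => \sum_i A (x + s *: w) i 0 * (S *m (x + s *: w)) i 0)).
    exact: (is_derive_sum_pt (fun i =>
      is_deriveM (is_derive_comp_curve dline (dAi i _)) (dSline i))).
  by apply/funext => s; rewrite bilinE.
apply: is_derive_eq dg _.
have dAE (z : 'cV[R]_3) i : 'D_z (fun z => A z i 0) y =
    \sum_j z j 0 * partial j (fun z => A z i 0) y by exact: derive_partials.
have -> : \sum_i (A y i 0 *: (S *m w) i 0
      + (S *m y) i 0 *: 'D_w (fun z => A z i 0) y) =
    \sum_i ((S *m y) i 0 * (\sum_j w j 0 * partial j (fun z => A z i 0) y)
      - w i 0 * (\sum_j (S *m y) j 0 * partial j (fun z => A z i 0) y)).
  rewrite sumrB big_split/= [LHS]addrC; congr (_ + _).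
    by apply: eq_bigr => i _; rewrite dAE.
  rewrite -[LHS](bilinE S (A y) w) bilin_skewC// bilinE.
  by congr (- _); apply: eq_bigr => i _; rewrite -dAE derive_equivariant.
rewrite bilinE -(curlA y) !sum_I3 !mxE.
(* Both sides are sums over the same nine partial derivatives once the indices
   are reduced modulo 3. *)
have two : 2 = 1 + 1 :> 'I_3 by exact: val_inj.
have three : 1 + 1 + 1 = 0 :> 'I_3 by exact: val_inj.
rewrite !(two, addrA, add0r, three).
pose a i j := partial j (fun z => A z i 0) y.
have aE i j : partial j (fun z => A z i 0) y = a i j by [].
(* Without this step [ring] compares its atoms, hence ordinals, by conversion,
   at great cost. *)
rewrite !aE; move: (\sum_j S 0 j * y j 0) (\sum_j S 1 j * y j 0)
  (\sum_j S (1 + 1) j * y j 0) (w 0 0) (w 1 0) (w (1 + 1) 0) (a 0 0) (a 0 1)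
  (a 0 (1 + 1)) (a 1 0) (a 1 1) (a 1 (1 + 1)) (a (1 + 1) 0) (a (1 + 1) 1)
  (a (1 + 1) (1 + 1)) => *; ring.
Qed.

(** A function with affine derivative is a quadratic polynomial, for which the
    central difference is exact and the average of the end values exceeds the
    middle value by [b / 8]. *)
Lemma affine_derivative_increments (R : realType) (f : R -> R) (a b : R) :
  (forall t, is_derive t (1 : R) f (a + t * b)) ->
  f 2^-1 - f (- 2^-1) = a /\ f 2^-1 + f (- 2^-1) = 2 * f 0 + b / 4.
Proof.
move=> df; pose g := f - (a *: id + (b / 2) *: (id ^+ 2)).
have dg t : is_derive t (1 : R) g 0.
  have did := is_derive_id t (1 : R).
  have dq := is_deriveD (is_deriveZ a did)
    (is_deriveZ (b / 2) (is_deriveX 2 did)).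
  apply: is_derive_eq (is_deriveB (df t) dq) _.
  by rewrite /GRing.scale/= expr1; field.
have := is_derive_0_is_cst 2^-1 0 dg.
have := is_derive_0_is_cst (- 2^-1) 0 dg.
rewrite /g !fctE/= /GRing.scale/=; split; lra.
Qed.

(** On a segment centred at [y] the momentum of the vector potential is a
    quadratic polynomial of the parameter, so both the central difference and
    the mean of the end values are known from [y] and the direction [w] alone. *)
Lemma potential_momentum_increments (R : realType) (A : 'cV[R]_3 -> 'cV[R]_3)
    (B : 'cV[R]_3) (S : 'M[R]_3) (y w : 'cV[R]_3)
    (g := fun z => bilin S (A z) z) :
  (forall z, differentiable A z) -> (forall z, curl A z = B) -> S^T = - S ->
  (forall tau z, expmx (- tau *: S) *m A (expmx (tau *: S) *m z) = A z) ->
  g (y + 2^-1 *: w) - g (y - 2^-1 *: w) = - bilin S (crossmul w B) y /\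
  g (y + 2^-1 *: w) + g (y - 2^-1 *: w) =
    2 * g y - bilin S (crossmul w B) w / 4.
Proof.
move=> dA curlA S_skew Ainv.
have dg t : is_derive t (1 : R) (fun s => g (y + s *: w))
    (- bilin S (crossmul w B) y + t * - bilin S (crossmul w B) w).
  rewrite mulrN -opprD -bilinZr -bilinDr.
  exact: is_derive_potential_momentum.
have := affine_derivative_increments dg.
by rewrite scale0r addr0 scaleNr mulNr.
Qed.

(** * One step of the method *)

(** The momentum is a quadratic polynomial of [(x, v)], so its value at the middle
    of two states differs from the mean of its two values by a quarter of its
    quadratic part on their difference.  For a step of the method that
    difference is [h] times [(v, v x B + F x)] at the midpoint; minus a quarter
    of the quadratic part there is the coefficient of [h ^+ 2]. *)
Definition midpoint_defect (R : realType) (F : 'cV[R]_3 -> 'cV[R]_3)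
    (B : 'cV[R]_3) (S : 'M[R]_3) (x v : 'cV[R]_3) : R :=
  - (bilin S (crossmul v B) v / 8 + bilin S (F x) v / 4).

(** Writing [c = v x B] at the midpoint [(x, v)], the bilinear part [v^T S x]
    increases by [h * bilin S (c + F x) x], since [bilin S v v = 0]; the momentum
    of the vector potential increases by [- h * bilin S c x]; and the force does
    not contribute because it is orthogonal to [S x].  The magnetic terms cancel,
    hence the momentum is conserved exactly at the grid points. *)
Lemma momentum_TSM1_step (R : realType) (A F : 'cV[R]_3 -> 'cV[R]_3)
    (B : 'cV[R]_3) (S : 'M[R]_3) (h : R) (x v : nat -> 'cV[R]_3) (n : nat) :
  (forall z, differentiable A z) -> (forall z, curl A z = B) -> S^T = - S ->
  (forall tau z, expmx (- tau *: S) *m A (expmx (tau *: S) *m z) = A z) ->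
  (forall z, bilin S (F z) z = 0) -> TSM1 F B h x v ->
  momentum A S (x n.+1) (v n.+1) = momentum A S (x n) (v n) /\
  momentum A S (midpoint x n) (midpoint v n) = momentum A S (x n) (v n)
    + h ^+ 2 * midpoint_defect F B S (midpoint x n) (midpoint v n).
Proof.
move=> dA curlA S_skew Ainv FS step; have [xS vS] := step n.
rewrite /midpoint_defect !momentumE.
set xb := midpoint x n in vS *; set vb := midpoint v n in xS vS *.
set c := crossmul vb B in vS *; set a := c + F xb.
have half (u : nat -> 'cV[R]_3) (d : 'cV[R]_3) : u n.+1 = u n + h *: d ->
    u n = midpoint u n - 2^-1 *: (h *: d) /\
    u n.+1 = midpoint u n + 2^-1 *: (h *: d).
  move=> uS; rewrite /midpoint uS; by split; apply/colP => i; rewrite !mxE; field.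
have [xL xR] := half x vb xS.
have [vL vR] : v n = vb - 2^-1 *: (h *: a) /\ v n.+1 = vb + 2^-1 *: (h *: a).
  by apply: half; rewrite vS scalerDr addrA.
have [] := potential_momentum_increments xb (h *: vb) dA curlA S_skew Ainv.
rewrite crossmulZl -/c -/xb -xL -xR => gB gD.
rewrite -/xb in xL xR.
have aE u : bilin S a u = bilin S c u + bilin S (F xb) u.
  exact: bilinDl.
(* The bilinearity rules must not look through these abbreviations. *)
clearbody a; clearbody c; clearbody xb vb.
have vb0 := bilin_skew_diag vb S_skew.
have eR : bilin S (v n.+1) (x n.+1) = bilin S vb xb
    + h / 2 * bilin S c xb
    + h ^+ 2 / 4 * (bilin S c vb + bilin S (F xb) vb).
  rewrite xR vR !(bilinDl, bilinDr, bilinZl, bilinZr) !aE FS vb0.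
  by field.
have eL : bilin S (v n) (x n) = bilin S vb xb
    - h / 2 * bilin S c xb
    + h ^+ 2 / 4 * (bilin S c vb + bilin S (F xb) vb).
  rewrite xL vL -2!(scaleNr 2^-1).
  rewrite !(bilinDl, bilinDr, bilinZl, bilinZr) !aE FS vb0.
  by field.
rewrite bilinZl in gB; rewrite bilinZl bilinZr in gD.
rewrite eR eL; split; lra.
Qed.

(** * Uniform bounds on the compact set *)

Lemma continuous_bilin (R : realType) (T : topologicalType) (n : nat)
    (S : 'M[R]_n) (f g : T -> 'cV[R]_n) :
  (forall i, continuous (fun t => f t i 0)) ->
  (forall i, continuous (fun t => g t i 0)) ->
  continuous (fun t => bilin S (f t) (g t)).
Proof.
move=> fc gc; rewrite (_ : (fun t => _) =
    (fun t => \sum_i \sum_j f t i 0 * (S i j * g t j 0))); last first.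
  apply/funext => t; rewrite bilinE; apply: eq_bigr => i _.
  by rewrite mxE mulr_sumr.
apply: (continuous_big (@add_continuous R)) => i _.
apply: (continuous_big (@add_continuous R)) => j _.
by move=> t; apply: cvgM; [exact: fc|apply: cvgM; [exact: cvg_cst|exact: gc]].
Qed.

Lemma continuous_midpoint_defect (R : realType) (T : topologicalType)
    (F : 'cV[R]_3 -> 'cV[R]_3) (B : 'cV[R]_3) (S : 'M[R]_3)
    (x v : T -> 'cV[R]_3) :
  (forall i, continuous (fun y => F y i 0)) -> continuous x -> continuous v ->
  continuous (fun t => midpoint_defect F B S (x t) (v t)).
Proof.
move=> Fc xc vc.
have vic i : continuous (fun t => v t i 0).
  by move=> t; exact: (@cvg_comp _ _ _ v (fun M => M i 0) _ _ _ (vc t)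
    (@coord_continuous _ _ _ i 0 _)).
have vBc i : continuous (fun t => crossmul (v t) B i 0).
  under [X in continuous X]funext do rewrite mxE.
  by move=> t; apply: cvgB; apply: cvgM; (exact: vic || exact: cvg_cst).
have Fxc i : continuous (fun t => F (x t) i 0).
  by move=> t; exact: (@cvg_comp _ _ _ x (fun y => F y i 0) _ _ _ (xc t)
    (Fc i _)).
have c1 := continuous_bilin (S := S) vBc vic.
have c2 := continuous_bilin (S := S) Fxc vic.
move=> t; apply: cvgN; apply: cvgD; apply: cvgM; try exact: cvg_cst.
  exact: c1.
exact: c2.
Qed.

Lemma compact_image_bounded (R : realType) (T : topologicalType) (K : set T)
    (f : T -> R) :
  compact K -> continuous f -> exists C, forall t, K t -> `|f t| <= C.
Proof.
move=> Kc fc.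
have /compact_bounded[C [_ CP]] : compact (f @` K).
  exact: continuous_compact (continuous_subspaceT fc) Kc.
by exists (C + 1) => t Kt; apply: (CP (C + 1)); [rewrite ltrDl|exists t].
Qed.

(* x h n and v h n are the n-th iterates computed with stepsize h; H is the set
   of stepsizes under consideration, e.g. all h > 0 or all 0 < h <= h0. *)
Theorem theorem3p3 (R : realType)
  (U : 'cV[R]_3 -> R) (A : 'cV[R]_3 -> 'cV[R]_3) (B : 'cV[R]_3) (S : 'M[R]_3)
  (U_smooth : smooth U) (A_smooth : smooth A)
  (curl_A : forall x, curl A x = B)
  (S_skew : S^T = - S)
  (U_inv : forall (tau : R) x, U (expmx (tau *: S) *m x) = U x)
  (A_inv : forall (tau : R) x,
     expmx (- tau *: S) *m A (expmx (tau *: S) *m x) = A x)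
  (H : set R) (H_gt0 : forall h, H h -> 0 < h)
  (x v : R -> nat -> 'cV[R]_3)
  (xv_TSM1 : forall h, H h -> TSM1 (fun y => - grad U y) B h (x h) (v h))
  (K : set ('cV[R]_3 * 'cV[R]_3)) (K_compact : compact K)
  (xv_K : forall h, H h -> forall n, K (x h n, v h n))
  (N : nat) (N_ge2 : (2 <= N)%N) :
  exists C2 : R, forall h, H h -> forall n : nat, n%:R * h <= h ^- N ->
    `| momentum A S (midpoint (x h) n) (midpoint (v h) n)
       - momentum A S (midpoint (x h) 0%N) (midpoint (v h) 0%N) |
    <= C2 * h ^+ 2.
Proof.
set F := fun y => - grad U y in xv_TSM1 *.
have [dU U1] := U_smooth 1%N; have [dA _] := A_smooth 1%N.
have FS z : bilin S (F z) z = 0.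
  have := derive_invariant (dU z) (U_inv ^~ z).
  rewrite derive_partials// => /(congr1 -%R); rewrite oppr0 -sumrN => <-.
  by rewrite bilinE; apply: eq_bigr => i _; rewrite !mxE mulNr mulrC.
have Fc i : continuous (fun y => F y i 0).
  rewrite (_ : (fun y => F y i 0) = (fun y => - 'D_(delta_mx i 0) U y)).
    exact: (fun y => continuousN (U1 (delta_mx i 0) y)).
  by apply/funext => y; rewrite !mxE.
pose Psi (pq : ('cV[R]_3 * 'cV[R]_3) * ('cV[R]_3 * 'cV[R]_3)) :=
  midpoint_defect F B S (2^-1 *: (pq.1.1 + pq.2.1)) (2^-1 *: (pq.1.2 + pq.2.2)).
have Psic : continuous Psi.
  apply: continuous_midpoint_defect => // pq; apply: cvgZ;
    try exact: cvg_cst; apply: cvgD.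
  - by apply: (cvg_comp _ _ cvg_fst); exact: cvg_fst.
  - by apply: (cvg_comp _ _ cvg_snd); exact: cvg_fst.
  - by apply: (cvg_comp _ _ cvg_fst); exact: cvg_snd.
  - by apply: (cvg_comp _ _ cvg_snd); exact: cvg_snd.
have [C PsiC] := compact_image_bounded (compact_setX K_compact K_compact) Psic.
(* Each of the two midpoints lies within [C * h ^+ 2] of the conserved value. *)
exists (2 * C) => h Hh n _.
have step m := momentum_TSM1_step m dA curl_A S_skew A_inv FS (xv_TSM1 h Hh).
have const m : momentum A S (x h m) (v h m) = momentum A S (x h 0%N) (v h 0%N).
  by elim: m => // m <-; have [] := step m.
have [_ ->] := step n; have [_ ->] := step 0%N.
rewrite (const n) opprD addrACA subrr add0r -mulrBr normrM.
rewrite (ger0_norm (sqr_ge0 _)) mulrC.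
rewrite ler_wpM2r ?sqr_ge0// (le_trans (ler_normB _ _))// mulr2n mulrDl mul1r.
have PsiE m : `|midpoint_defect F B S (midpoint (x h) m) (midpoint (v h) m)| <= C.
  apply: (PsiC ((x h m, v h m), (x h m.+1, v h m.+1))).
  by split; exact: xv_K.
exact: lerD.
Qed.
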